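(* Let $a,b$ be positive integers. Let $p_{n,\ell}^{(a,b)}$ be the total number of peaks at level $\ell+1$ over all colored $(a,b)$-Dyck paths of length $2n+2$. Then for all integers $n\ge\ell\ge0$, $$p_{n,\ell}^{(a,b)}=\sum_{j=0}^{n-\ell}\frac{2a(\ell+1)}{2n-j+2}\binom{2n-j+2}{n-\ell}\binom{n-\ell}{j}(a-b)^{j}b^{n-j},$$ with $p_{0,0}^{(a,b)}=a$. Moreover, $p_{n,\ell}^{(a,b)}$ is the $(n,\ell)$-entry of the Riordan array $\left(aC(a,b;x)^2,\ bxC(a,b;x)^2\right)$, i.e. $p_{n,\ell}^{(a,b)}=[x^n]\,aC(a,b;x)^2\left(bxC(a,b;x)^2\right)^{\ell}$.
   Context: A Dyck path of length $2n$ is a lattice path from $(0,0)$ to $(2n,0)$ weakly above the $x$-axis with steps $\mathbf{u}=(1,1)$, $\mathbf{d}=(1,-1)$. A colored $(a,b)$-Dyck path is a Dyck path in which each $\mathbf{d}$-step that is part of a peak (i.e. immediately preceded by a $\mathbf{u}$-step) is colored with one of $a$ colors and every other $\mathbf{d}$-step is colored with one of $b$ colors. A peak is a $\mathbf{u}$-step immediately followed by a $\mathbf{d}$-step; its level is the ordinate of the common point. $C(a,b;x)=\frac{1-(a-b)x-\sqrt{(1-(a-b)x)^2-4bx}}{2bx}$ is the unique power series with $C=1+(a-b)xC+bxC^2$. A Riordan array $(d(x),h(x))$ has $(n,k)$-entry $[x^n]d(x)h(x)^k$. *)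

(* Defs.v *)
From HB Require Import structures.
From mathcomp Require Import all_boot all_order all_algebra.
From mathcomp Require Import boolp ring.
Set Implicit Arguments.
Unset Strict Implicit.
Unset Printing Implicit Defensive.
Import Order.TTheory GRing.Theory Num.Theory.
Local Open Scope ring_scope.

(* A step of a colored path: [None] is u, [Some (inl c)] is a d-step carrying
   one of the a peak colors, [Some (inr c)] is a d-step carrying one of the b
   other colors. *)
Definition cstep (a b : nat) : Type := option ('I_a + 'I_b).
HB.instance Definition _ a b := Finite.on (cstep a b).

Section ColoredDyckPaths.
Variables a b : nat.
Implicit Types (s : cstep a b) (P : seq (cstep a b)).

Definition is_up s : bool := if s is None then true else false.
Definition is_down s : bool := ~~ is_up s.

Definition step P (i : nat) : cstep a b := nth (None : cstep a b) P i.

Definition height P : int := (count is_up P)%:Z - (count is_down P)%:Z.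

Definition dyck P : bool :=
  [forall i : 'I_(size P).+1, 0 <= height (take i P)] && (height P == 0).

(* Steps are numbered from 0; a peak is named by the index of its u-step. *)
Definition peak P (i : nat) : bool :=
  [&& (i.+1 < size P)%N, is_up (step P i) & is_down (step P i.+1)].

Definition peak_level P (i : nat) : int := height (take i.+1 P).

Definition well_colored P : bool :=
  [forall i : 'I_(size P),
     match step P i with
     | None => true
     | Some (inl _) => (0 < i)%N && peak P i.-1
     | Some (inr _) => ~~ ((0 < i)%N && peak P i.-1)
     end].

Definition colored_dyck P : bool := dyck P && well_colored P.

Definition nb_peaks P (k : nat) : nat :=
  #|[set i : 'I_(size P) | peak P i && (peak_level P i == k%:Z)]|.

End ColoredDyckPaths.

Definition total_peaks (a b n l : nat) : nat :=
  \sum_(P : (2 * n + 2).-tuple (cstep a b) | colored_dyck P) nb_peaks P l.+1.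

(* Formal power series, as their sequences of coefficients. *)
Record fps (R : Type) := Fps { fps_coef : nat -> R }.

Coercion fps_coef : fps >-> Funclass.

Lemma fpsP (R : Type) (f g : fps R) : (forall n, f n = g n) -> f = g.
Proof. by case: f g => [f] [g] /= fg; congr Fps; apply: funext. Qed.

HB.instance Definition _ (R : Type) := gen_eqMixin (fps R).
HB.instance Definition _ (R : Type) := gen_choiceMixin (fps R).

Section FpsRing.
Variable R : comNzRingType.
Implicit Types f g h : fps R.

Definition fps_const (c : R) : fps R := Fps (fun n => if n == 0%N then c else 0).
Definition fps_X : fps R := Fps (fun n => (n == 1%N)%:R).
Definition fps_add f g : fps R := Fps (fun n => f n + g n).
Definition fps_opp f : fps R := Fps (fun n => - f n).
Definition fps_mul f g : fps R :=
  Fps (fun n => \sum_(i < n.+1) f i * g (n - i)%N).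

Fact fps_addA : associative fps_add.
Proof. by move=> f g h; apply: fpsP => n /=; rewrite addrA. Qed.
Fact fps_addC : commutative fps_add.
Proof. by move=> f g; apply: fpsP => n /=; rewrite addrC. Qed.
Fact fps_add0 : left_id (fps_const 0) fps_add.
Proof. by move=> f; apply: fpsP => n /=; rewrite if_same add0r. Qed.
Fact fps_addN : left_inverse (fps_const 0) fps_opp fps_add.
Proof. by move=> f; apply: fpsP => n /=; rewrite if_same addNr. Qed.

HB.instance Definition _ :=
  GRing.isZmodule.Build (fps R) fps_addA fps_addC fps_add0 fps_addN.

Definition fps_trunc (n : nat) f : {poly R} := \poly_(i < n.+1) f i.

Fact coef_trunc n f i : (i <= n)%N -> (fps_trunc n f)`_i = f i.
Proof. by move=> le_in; rewrite coef_poly ltnS le_in. Qed.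

Fact coef_mul_trunc n f g i :
  (i <= n)%N -> (fps_mul f g) i = (fps_trunc n f * fps_trunc n g)`_i.
Proof.
move=> le_in; rewrite coefM /=; apply: eq_bigr => j _.
rewrite !coef_trunc ?(leq_trans (leq_subr _ _)) //.
by rewrite (leq_trans _ le_in) // -ltnS.
Qed.

Fact fps_mulC : commutative fps_mul.
Proof.
by move=> f g; apply: fpsP => n; rewrite !(@coef_mul_trunc n) // mulrC.
Qed.

Fact fps_mulA : associative fps_mul.
Proof.
move=> f g h; apply: fpsP => n.
transitivity (fps_trunc n f * (fps_trunc n g * fps_trunc n h))`_n.
  rewrite coefM; apply: eq_bigr => i _.
  by rewrite (@coef_mul_trunc n) ?leq_subr // coef_trunc // -ltnS.
rewrite mulrA coefM; apply: eq_bigr => i _.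
by rewrite (@coef_mul_trunc n) ?coef_trunc ?leq_subr // -ltnS.
Qed.

Fact coef_const_mul c f n : (fps_mul (fps_const c) f) n = c * f n.
Proof.
by rewrite /= big_ord_recl /= subn0 big1 ?addr0 // => i _; rewrite mul0r.
Qed.

Fact fps_mul1 : left_id (fps_const 1) fps_mul.
Proof. by move=> f; apply: fpsP => n; rewrite coef_const_mul mul1r. Qed.

Fact fps_mulDl : left_distributive fps_mul fps_add.
Proof.
move=> f g h; apply: fpsP => n /=; rewrite -big_split /=.
by apply: eq_bigr => i _; rewrite mulrDl.
Qed.

Fact fps_1neq0 : fps_const 1 != fps_const 0.
Proof.
apply/eqP => /(congr1 (fun f => f 0)) /= /eqP.
by rewrite (negPf (oner_neq0 R)).
Qed.

HB.instance Definition _ := GRing.Zmodule_isComNzRing.Build (fps R)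
  fps_mulA fps_mulC fps_mul1 fps_mulDl fps_1neq0.

Lemma coef_fpsD f g n : (f + g) n = f n + g n. Proof. by []. Qed.
Lemma coef_fpsN f n : (- f) n = - f n. Proof. by []. Qed.
Lemma coef_fpsB f g n : (f - g) n = f n - g n. Proof. by []. Qed.
Lemma coef_fps0 n : (0 : fps R) n = 0. Proof. exact: if_same. Qed.
Lemma coef_fps1 n : (1 : fps R) n = (n == 0%N)%:R.
Proof. by rewrite /= ; case: n. Qed.
Lemma coef_fpsM f g n :
  (f * g) n = \sum_(i < n.+1) f i * g (n - i)%N.
Proof. by []. Qed.
Lemma coef_fpsCM c f n : (fps_const c * f) n = c * f n.
Proof. exact: coef_const_mul. Qed.
Lemma coef_fpsXM f n : (fps_X * f) n = if n is m.+1 then f m else 0.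
Proof.
case: n => [|n]; rewrite coef_fpsM big_ord_recl /= mul0r add0r ?big_ord0 //.
by rewrite big_ord_recl /= mul1r subSS subn0 big1 ?addr0 // => i _; rewrite mul0r.
Qed.

Lemma fps_natr n : n%:R = fps_const n%:R.
Proof.
elim: n => [|n IHn]; first by [].
by rewrite -natr1 IHn; apply: fpsP => -[|k]; rewrite coef_fpsD /= ?addr0 ?natr1.
Qed.

Lemma fps_X_inj f g : fps_X * f = fps_X * g -> f = g.
Proof.
move=> fg; apply: fpsP => n.
by move/(congr1 (fun h => h n.+1)): fg; rewrite !coef_fpsXM.
Qed.

(* Division by x of a series without constant term. *)
Definition fps_divX f : fps R := Fps (fun n => f n.+1).

Lemma fps_divXK f : f 0 = 0 -> fps_X * fps_divX f = f.
Proof. by move=> f0; apply: fpsP => -[|n]; rewrite coef_fpsXM ?f0. Qed.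

Definition riordan (d h : fps R) (n k : nat) : R := (d * h ^+ k) n.

End FpsRing.

Section FpsSqrt.
Variable F : numFieldType.
Implicit Types f g : fps F.

(* The square root with constant term 1 of a series with constant term 1,
   obtained by solving s ^+ 2 = f coefficient by coefficient. *)
Fixpoint sqrt_prefix f (n : nat) : seq F :=
  if n is m.+1 then
    let s := sqrt_prefix f m in
    rcons s ((f m.+1 - \sum_(1 <= i < m.+1) s`_i * s`_(m.+1 - i)) / 2)
  else [:: 1].

Definition fps_sqrt f : fps F := Fps (fun n => (sqrt_prefix f n)`_n).

Lemma size_sqrt_prefix f n : size (sqrt_prefix f n) = n.+1.
Proof. by elim: n => //= n IHn; rewrite size_rcons IHn. Qed.

Lemma nth_sqrt_prefix f n i :
  (i <= n)%N -> (sqrt_prefix f n)`_i = (fps_sqrt f) i.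
Proof.
elim: n => [|n IHn]; first by case: i.
rewrite leq_eqVlt => /predU1P[-> //|lt_in].
by rewrite /= nth_rcons size_sqrt_prefix lt_in IHn.
Qed.

Lemma fps_sqrt0 f : (fps_sqrt f) 0 = 1. Proof. by []. Qed.

Lemma fps_sqrK f : f 0%N = 1 -> fps_sqrt f ^+ 2 = f.
Proof.
move=> f0; apply: fpsP => -[|n].
  by rewrite expr2 coef_fpsM big_ord1 !fps_sqrt0 mulr1 f0.
pose G i : F := fps_sqrt f i * fps_sqrt f (n.+1 - i)%N.
rewrite expr2 coef_fpsM -(big_mkord xpredT G) big_nat_recr //= big_ltn //.
rewrite {1 3}/G subn0 subnn fps_sqrt0 mulr1 mul1r.
have -> : fps_sqrt f n.+1 = (f n.+1 - \sum_(1 <= i < n.+1) G i) / 2.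
  rewrite /= nth_rcons size_sqrt_prefix ltnn eqxx; congr ((_ - _) / 2).
  apply: eq_big_nat => i /andP[i_gt0 lt_in].
  by rewrite !nth_sqrt_prefix // leq_subLR addnC -addn1 leq_add2l.
set S := \sum_(_ <= i < _) _; rewrite addrAC -splitr subrK.
by [].
Qed.

End FpsSqrt.

Section GeneratingFunction.
Variables a b : nat.

(* C(a,b;x) = (1 - (a-b)x - sqrt((1 - (a-b)x)^2 - 4bx)) / (2bx), computed over
   the rationals; it is junk when b = 0. *)
Definition C_discr : fps rat :=
  (1 - (a%:R - b%:R) * fps_X rat) ^+ 2 - 4 * b%:R * fps_X rat.

Definition C_num : fps rat :=
  1 - (a%:R - b%:R) * fps_X rat - fps_sqrt C_discr.

Definition C_series : fps rat := fps_const (2 * b%:R)^-1 * fps_divX C_num.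

Definition C_equation (f : fps rat) : Prop :=
  f = 1 + (a%:R - b%:R) * fps_X rat * f + b%:R * fps_X rat * f ^+ 2.

Lemma C_discr0 : C_discr 0%N = 1.
Proof.
by rewrite /C_discr coef_fpsB expr2 coef_fpsM big_ord1 !coef_fpsB
  ![_ * fps_X rat]mulrC !coef_fpsXM coef_fps1 !subr0 mulr1.
Qed.

Lemma C_seriesE : (0 < b)%N ->
  2 * b%:R * fps_X rat * C_series
    = 1 - (a%:R - b%:R) * fps_X rat - fps_sqrt C_discr.
Proof.
move=> b_gt0; rewrite -/C_num -[RHS]fps_divXK; last first.
  by rewrite !coef_fpsB [_ * fps_X rat]mulrC coef_fpsXM coef_fps1
    fps_sqrt0 subr0 subrr.
rewrite [2 * _ * _]mulrC -mulrA; congr (_ * _).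
rewrite -natrM fps_natr mulrA; apply: fpsP => n.
rewrite -mulrA !coef_fpsCM mulrA natrM mulfV ?mul1r //.
by rewrite mulf_neq0 // pnatr_eq0 -lt0n.
Qed.

Lemma C_series_sol : (0 < b)%N -> C_equation C_series.
Proof.
move=> b_gt0; have := fps_sqrK C_discr0.
have -> : fps_sqrt C_discr
    = 1 - (a%:R - b%:R) * fps_X rat - 2 * b%:R * fps_X rat * C_series.
  by rewrite C_seriesE // opprB addrC subrK.
rewrite {1}/C_discr /C_equation; set X := fps_X rat; set f := C_series => sqE.
apply/eqP; rewrite -subr_eq0; apply/eqP.
set D := (X in X = 0).
have: (4 * b)%:R * (X * D) = 0.
  transitivity ((1 - (a%:R - b%:R) * X) ^+ 2
    - (1 - (a%:R - b%:R) * X - 2 * b%:R * X * f) ^+ 2 - 4 * b%:R * X).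
    by rewrite /D natrM; ring.
  by rewrite sqE; ring.
rewrite fps_natr => D0; apply: fps_X_inj; rewrite mulr0; apply: fpsP => n.
move/(congr1 (fun g : fps rat => g n)): D0.
rewrite coef_fpsCM coef_fps0 => /eqP.
by rewrite mulf_eq0 pnatr_eq0 muln_eq0 /= eqn0Ngt b_gt0 => /eqP.
Qed.

Lemma C_equation_uniq f g : C_equation f -> C_equation g -> f = g.
Proof.
have step (h : fps rat) n : C_equation h -> h n.+1
    = (a%:R - b%:R) * h n + b%:R * \sum_(i < n.+1) h i * h (n - i)%N.
  move=> {1}->; rewrite !coef_fpsD coef_fps1 add0r ![_ * fps_X rat]mulrC.
  rewrite -!mulrA !coef_fpsXM mulrBl coef_fpsB !fps_natr !coef_fpsCM.
  by rewrite -mulrBl expr2.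
have init (h : fps rat) : C_equation h -> h 0%N = 1.
  move=> ->; rewrite !coef_fpsD coef_fps1 ![_ * fps_X rat]mulrC.
  by rewrite -!mulrA !coef_fpsXM !addr0.
move=> fE gE; apply: fpsP => n.
have [m] := ubnP n; elim: m n => // m IHm [|n] lt_nm; first by rewrite !init.
rewrite !step // IHm //; congr (_ + _ * _); apply: eq_bigr => i _.
have le_in : (i <= n)%N by rewrite -ltnS.
have lt_n : (n < m)%N by rewrite -ltnS.
rewrite (IHm i) ?(leq_ltn_trans le_in) //.
by rewrite (IHm (n - i)%N) ?(leq_ltn_trans (leq_subr _ _)).
Qed.

End GeneratingFunction.

(* Main.v *)
Require Import Defs.
From HB Require Import structures.
From mathcomp Require Import all_boot all_order all_algebra.
From mathcomp Require Import ring lra zify.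
Set Implicit Arguments.
Unset Strict Implicit.
Unset Printing Implicit Defensive.
Import Order.TTheory GRing.Theory Num.Theory.
Local Open Scope ring_scope.

(* Cut a path at a peak of level l+1. With t marking steps, x = t^2 and
   D = C(x), the prefixes that end with the u-step of the peak have generating
   function t^(l+1) D^(l+1). After the d-step of the peak, coloured in a ways,
   the suffixes starting at height l have generating function
   (b t)^l D^(l+1), since their l descents to a new minimum never
   end a peak. The product is a b^l t^(2l+1) D^(2l+2), whose coefficient at
   t^(2n+1) is the Riordan entry. The two generating functions are verified
   against the one-step recurrences of an automaton whose states record the
   height and whether the last step was a u-step.
   The closed form of [x^m] C^r follows from
   C^(r+1) = C^r + (a-b) x C^(r+1) + b x C^(r+2), which determines these
   coefficients and reduces, term by term in j, to a binomial identity. *)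

(** * Sums over steps and over tuples of steps *)

Lemma big_option (R : Type) (idx : R) (op : Monoid.com_law idx) (T : finType)
    (F : option T -> R) :
  \big[op/idx]_s F s = op (F None) (\big[op/idx]_(x : T) F (Some x)).
Proof.
have enum_optionE : enum {: option T} = None :: map Some (enum T).
  by rewrite !enumT [in LHS]unlock.
by rewrite -big_enum enum_optionE big_cons big_map big_enum.
Qed.

Lemma sum_cstep (a b : nat) (F : cstep a b -> nat) (u p d : nat) :
    F None = u -> (forall c, F (Some (inl c)) = p) ->
    (forall c, F (Some (inr c)) = d) ->
  (\sum_(s : cstep a b) F s = u + (a * p + b * d))%N.
Proof.
move=> Fu Fp Fd; rewrite [LHS]big_option Fu big_sumType /=.
rewrite (eq_bigr (fun=> p)) // [X in (_ + (_ + X))%N](eq_bigr (fun=> d)) //.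
by rewrite !sum_nat_const !card_ord.
Qed.

Lemma sum_tuple0 (T : finType) (F : seq T -> nat) :
  (\sum_(P : 0.-tuple T) F P = F [::])%N.
Proof.
rewrite (big_pred1 [tuple]) // => P; apply/esym/eqP; exact: tuple0.
Qed.

Lemma sum_tupleS (T : finType) m (F : seq T -> nat) :
  (\sum_(P : m.+1.-tuple T) F P = \sum_(s : T) \sum_(P : m.-tuple T) F (s :: P))%N.
Proof.
rewrite pair_big /= (reindex (fun q : T * m.-tuple T => [tuple of q.1 :: q.2])) //=.
exists (fun P => (thead P, [tuple of behead P])) => [[s P] _|P _] /=.
  by congr pair; apply: val_inj.
by rewrite -tuple_eta.
Qed.

Lemma forall_ordS n (p : pred nat) :
  [forall i : 'I_n.+1, p i] = p 0%N && [forall i : 'I_n, p i.+1].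
Proof.
apply/forallP/andP => [p_all|[p0 /forallP pS] i].
  by split; [exact: (p_all ord0) | apply/forallP => i; exact: (p_all (lift ord0 i))].
by case: (unliftP ord0 i) => [j|] -> //; exact: pS.
Qed.

(** * Colored Dyck paths as runs of an automaton *)

Section Scan.
Variables a b : nat.
Implicit Types (s : cstep a b) (P : seq (cstep a b)) (h k m : nat) (f : bool).

(* The state of a scan is the current height [h] and the flag [f] telling
   whether the previous step was a u-step. *)
Fixpoint completes h f P : bool :=
  match P with
  | [::] => h == 0%N
  | None :: Q => completes h.+1 true Q
  | Some (inl _) :: Q => [&& (0 < h)%N, f & completes h.-1 false Q]
  | Some (inr _) :: Q => [&& (0 < h)%N, ~~ f & completes h.-1 false Q]
  end.

(** A peak is credited at its d-step, when the current height is still the level of its top. *)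
Fixpoint peaks_from k h f P : nat :=
  match P with
  | [::] => 0
  | None :: Q => peaks_from k h.+1 true Q
  | Some _ :: Q => (f && (h == k)) + peaks_from k h.-1 false Q
  end.

(** The start height is a parameter so that steps can be peeled off one by one; it is an integer so
    that a descent below the axis is seen as [-1]. *)
Definition dyck_from (z : int) P :=
  [forall i : 'I_(size P).+1, 0 <= z + height (take i P)]
    && (z + height P == 0).

Definition well_colored_from f P :=
  [forall i : 'I_(size P),
     let p := if (i : nat) is j.+1 then peak P j else f in
     match step P i with
     | None => true | Some (inl _) => p | Some (inr _) => ~~ p
     end].

(** The first term accounts for a peak whose u-step comes just before [P], as recorded by [f]. *)
Definition nb_peaks_from (z : int) f P k : nat :=
  ([&& f, (0 < size P)%N, is_down (step P 0) & z == k%:Z]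
   + \sum_(i < size P) (peak P i && (z + height (take i.+1 P) == k%:Z)%R))%N.

Lemma height_cons s P :
  height (s :: P) = (if is_up s then 1 else -1) + height P.
Proof. by rewrite /height /= /is_down; case: (is_up s) => /=; lia. Qed.

Lemma dyck_from_cons z s P :
  dyck_from z (s :: P)
    = (0 <= z) && dyck_from (z + (if is_up s then 1 else -1)) P.
Proof.
rewrite /dyck_from (forall_ordS _ (fun i => 0 <= z + height (take i (s :: P)))).
rewrite /= addr0 height_cons addrA -andbA; congr [&& _, _ & _].
by apply: eq_forallb => i; rewrite height_cons addrA.
Qed.

Lemma well_colored_from_cons f s P :
  well_colored_from f (s :: P)
    = (match s with None => true | Some (inl _) => f | Some (inr _) => ~~ f end)
      && well_colored_from (is_up s) P.
Proof.
rewrite /well_colored_from /=.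
rewrite (forall_ordS _ (fun i => let p := if i is j.+1 then peak (s :: P) j else f in
     match step (s :: P) i with
     | None => true | Some (inl _) => p | Some (inr _) => ~~ p end)) /=.
congr (_ && _); apply: eq_forallb => -[[|i] lt_i] //=.
rewrite /peak /= ltnS lt_i /=.
by case: P lt_i => [|[[c|c]|] P] //= _; rewrite /step /= ?andbT.
Qed.

Lemma nb_peaks_from_cons z f s P k :
  nb_peaks_from z f (s :: P) k
    = ([&& f, is_down s & z == k%:Z]
       + nb_peaks_from (z + (if is_up s then 1 else -1))%R (is_up s) P k)%N.
Proof.
rewrite /nb_peaks_from /= big_ord_recl /= take0 height_cons addr0.
congr (_ + (_ + _))%N; last first.
  by apply: eq_bigr => i _; rewrite height_cons addrA.
rewrite /peak /= ltnS; congr (nat_of_bool _).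
by rewrite -!andbA /step /=; case: (is_up s); case: (0 < size P)%N.
Qed.

Lemma dyck_from_ge0 z P : dyck_from z P -> 0 <= z.
Proof. by case/andP => /forallP/(_ ord0); rewrite take0 addr0. Qed.

Lemma dyck_fromN1 P : dyck_from (0%:Z - 1) P = false.
Proof. by apply/negP => /dyck_from_ge0. Qed.

Lemma completesE h f P :
  completes h f P = dyck_from h%:Z P && well_colored_from f P.
Proof.
elim: P h f => [|s P IHP] h f.
  apply/eqP/andP => [->|[/andP[_ /eqP]]]; last by rewrite /height /=; lia.
  by split; [apply/andP; split => // | ]; apply/forallP => -[].
rewrite dyck_from_cons well_colored_from_cons /=.
case: s => [[c|c]|] /=; last by rewrite IHP; have -> : h%:Z + 1 = h.+1%:Z by lia.
- case: h => [|h]; first by rewrite dyck_fromN1.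
  have -> : h.+1%:Z - 1 = h%:Z by lia.
  by rewrite IHP; case: f; rewrite ?andbF.
- case: h => [|h]; first by rewrite dyck_fromN1.
  have -> : h.+1%:Z - 1 = h%:Z by lia.
  by rewrite IHP; case: f; rewrite ?andbF.
Qed.

(** The hypothesis forces a positive height before every d-step, so the truncated [h.-1] in
    [peaks_from] is the true height. *)
Lemma peaks_fromE k h f P :
  completes h f P -> nb_peaks_from h%:Z f P k = peaks_from k h f P.
Proof.
elim: P h f => [|s P IHP] h f.
  by rewrite /nb_peaks_from /= big_ord0 andbF.
rewrite nb_peaks_from_cons; case: s => [[c|c]|] /=.
- case/and3P; case: h => // h _ -> /IHP <-; rewrite /= -[_ == _ :> int]/(h.+1 == k).
  by have -> : h.+1%:Z - 1 = h%:Z by lia.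
- case/and3P; case: h => // h _ /negPf-> /IHP <-; rewrite /=.
  by have -> : h.+1%:Z - 1 = h%:Z by lia.
by move/IHP <-; rewrite andbF; have -> : h%:Z + 1 = h.+1%:Z by lia.
Qed.

Lemma colored_dyckE P : colored_dyck P = completes 0 false P.
Proof.
rewrite completesE /colored_dyck /dyck /dyck_from add0r.
congr (_ && _ && _); first by apply: eq_forallb => i; rewrite add0r.
apply: eq_forallb => -[[|i] lt_i] //=.
Qed.

Lemma nb_peaksE k P :
  colored_dyck P -> nb_peaks P k = peaks_from k 0 false P.
Proof.
rewrite colored_dyckE => /peaks_fromE <-.
rewrite /nb_peaks /nb_peaks_from /= add0n -sum1dep_card [LHS]big_mkcond /=.
by apply: eq_bigr => i _; rewrite add0r; case: (_ && _).
Qed.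

Definition nb_completions m h f : nat :=
  (\sum_(P : m.-tuple (cstep a b)) completes h f P)%N.

Definition sum_peaks k m h f : nat :=
  (\sum_(P : m.-tuple (cstep a b)) completes h f P * peaks_from k h f P)%N.

Lemma total_peaksE n l : total_peaks a b n l = sum_peaks l.+1 (2 * n + 2) 0 false.
Proof.
rewrite /total_peaks /sum_peaks big_mkcond; apply: eq_bigr => P _ /=.
rewrite -colored_dyckE; case: ifP => // /nb_peaksE ->.
by rewrite mul1n.
Qed.

Definition down_weight f : nat := if f then a else b.

Lemma nb_completions0 h f : nb_completions 0 h f = (h == 0%N).
Proof. exact: (sum_tuple0 (completes h f : _ -> nat)). Qed.

Lemma nb_completionsS m h f :
  nb_completions m.+1 h f
    = (nb_completions m h.+1 true
       + (0 < h) * down_weight f * nb_completions m h.-1 false)%N.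
Proof.
rewrite {1}/nb_completions (sum_tupleS _ (completes h f : _ -> nat)).
under eq_bigr do rewrite /=.
rewrite (sum_cstep (u := nb_completions m h.+1 true)
  (p := ((0 < h) * f * nb_completions m h.-1 false)%N)
  (d := ((0 < h) * ~~ f * nb_completions m h.-1 false)%N)) //=.
- by rewrite /down_weight; case: (0 < h)%N; case: f; lia.
all: move=> c; rewrite [in RHS]big_distrr; apply: eq_bigr => P _.
all: by rewrite -!mulnb mulnA.
Qed.

Lemma sum_peaks0 k h f : sum_peaks k 0 h f = 0%N.
Proof. by rewrite /sum_peaks big1 // => P _; rewrite tuple0 muln0. Qed.

(** A d-step that closes a peak of level [k] adds one peak to each completion that follows it, hence
    the [nb_completions] term. *)
Lemma sum_peaksS k m h f :
  sum_peaks k m.+1 h f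
    = (sum_peaks k m h.+1 true
       + (0 < h) * down_weight f
         * (f * (h == k) * nb_completions m h.-1 false
            + sum_peaks k m h.-1 false))%N.
Proof.
rewrite {1}/sum_peaks.
rewrite (sum_tupleS _ (fun P => completes h f P * peaks_from k h f P)%N).
pose t := (f * (h == k) * nb_completions m h.-1 false
            + sum_peaks k m h.-1 false)%N.
rewrite (sum_cstep (u := sum_peaks k m h.+1 true)
  (p := ((0 < h) * f * t)%N) (d := ((0 < h) * ~~ f * t)%N)) //=.
- by rewrite /down_weight -/t; move: t; case: (0 < h)%N; case: f => t; lia.
all: move=> c; rewrite /t /nb_completions /sum_peaks big_distrr -big_split.
all: by rewrite [in RHS]big_distrr; apply: eq_bigr => P _ /=; rewrite -!mulnb; nia.
Qed.

End Scan.

(** * Substitution of the square of the variable into a series *)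

Section FpsSquareSubstitution.
Variable R : comNzRingType.
Implicit Types f g : fps R.

Lemma coef_fps_natM k f n : (k%:R * f) n = k%:R * f n.
Proof. by rewrite fps_natr coef_fpsCM. Qed.

Lemma coef_fps_natXM k e f n : (k%:R ^+ e * f) n = k%:R ^+ e * f n.
Proof. by rewrite -natrX coef_fps_natM natrX. Qed.

Lemma coef_fpsXnM k f n :
  (fps_X R ^+ k * f) n = if (k <= n)%N then f (n - k)%N else 0.
Proof.
elim: k n => [|k IHk] n; first by rewrite mul1r subn0.
by rewrite exprS -mulrA coef_fpsXM; case: n => // n; rewrite IHk.
Qed.

Definition fps_squareX f : fps R := Fps (fun n => if odd n then 0 else f n./2).

Lemma coef_squareX_double f n : fps_squareX f n.*2 = f n.
Proof. by rewrite /= odd_double doubleK. Qed.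

Lemma sum_even n (F : nat -> R) : (forall i, odd i -> F i = 0) ->
  \sum_(i < n.*2.+1) F i = \sum_(i < n.+1) F i.*2.
Proof.
move=> F_odd; elim: n => [|n IHn]; first by rewrite !big_ord1.
rewrite doubleS 2!big_ord_recr /= IHn [RHS]big_ord_recr /=.
by rewrite (F_odd n.*2.+1) ?addr0 //= odd_double.
Qed.

Fact fps_squareX_is_zmod_morphism : zmod_morphism fps_squareX.
Proof. by move=> f g; apply: fpsP => n /=; case: odd; rewrite ?oppr0 ?addr0. Qed.

Fact fps_squareX_is_monoid_morphism : monoid_morphism fps_squareX.
Proof.
split=> [|f g]; apply: fpsP => n; rewrite -[n]odd_double_half.
  case: (odd n) (n./2) => m; first by rewrite add1n /= odd_double.
  by rewrite add0n coef_squareX_double; case: m.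
case: (odd n) (n./2) => m; rewrite ?add1n ?add0n.
  rewrite coef_fpsM /= odd_double /= big1 // => i _.
  have: odd i || odd (m.*2.+1 - i).
    have le_i : (i <= m.*2.+1)%N by rewrite -ltnS.
    by rewrite oddB //= odd_double; case: (odd i).
  by case/orP => /= ->; rewrite ?mul0r ?mulr0.
rewrite coef_squareX_double !coef_fpsM.
rewrite (@sum_even m (fun i => fps_squareX f i * fps_squareX g (m.*2 - i)%N)).
  by apply: eq_bigr => i _; rewrite -doubleB !coef_squareX_double.
by move=> i /= ->; rewrite mul0r.
Qed.

HB.instance Definition _ :=
  GRing.isZmodMorphism.Build _ _ fps_squareX fps_squareX_is_zmod_morphism.
HB.instance Definition _ :=
  GRing.isMonoidMorphism.Build _ _ fps_squareX fps_squareX_is_monoid_morphism.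

Lemma fps_squareX_X : fps_squareX (fps_X R) = fps_X R ^+ 2.
Proof.
apply: fpsP => n; rewrite expr2 coef_fpsXM /=.
by case: n => [|[|[|[|n]]]] //=; rewrite if_same.
Qed.

End FpsSquareSubstitution.

(** * Peak counts as a convolution of prefixes and suffixes *)

Section PrefixSuffix.
Variables (R : comNzRingType) (a b : nat).
(* [U i h f] is the weighted number of prefixes of length [i] that lead to the
   state [(h, f)]; its step is the transpose of the one of [sum_peaks]. *)
Variable U : nat -> nat -> bool -> R.
Hypothesis U_init : U 0 0 false = 1.
Hypothesis U_bound : forall i h f, (i < h)%N -> U i h f = 0.
Hypothesis U_ground : forall i, U i 0 true = 0.
Hypothesis U_up : forall i h, U i.+1 h.+1 true = U i h true + U i h false.
Hypothesis U_down : forall i h,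
  U i.+1 h false = a%:R * U i h.+1 true + b%:R * U i h.+1 false.

(** Counts the peaks of level [k] whose d-step is among the last [m] steps, the first [i] steps
    being weighted by [U]. *)
Definition pairing k m i : R :=
  \sum_(h < i.+1) (U i h true * (sum_peaks a b k m h true)%:R
                   + U i h false * (sum_peaks a b k m h false)%:R).

(** The steps of [U] and [sum_peaks] are adjoint, so handing one step over to the prefix loses only
    the peaks closed by that very step: a d-step from state [(k.+1, true)], in [a] colors. *)
Lemma pairing_step k m i :
  pairing k.+1 m.+1 i
    = pairing k.+1 m i.+1
      + U i k.+1 true * (a%:R * (nb_completions a b m k false)%:R).
Proof.
rewrite {1}/pairing.
pose T h f : R := (sum_peaks a b k.+1 m h f)%:R.
pose W h : R := (nb_completions a b m h false)%:R.
transitivity (\sum_(h < i.+1) (U i h true + U i h false) * T h.+1 true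
    + \sum_(h < i.+1)
        (0 < h)%:R * (a%:R * U i h true + b%:R * U i h false) * T h.-1 false
    + \sum_(h < i.+1) (h == k.+1 :> nat)%:R * (U i h true * (a%:R * W h.-1))).
  rewrite -!big_split; apply: eq_bigr => h _ /=.
  rewrite !sum_peaksS /T /W !(natrD, natrM) /down_weight.
  by case: (h : nat) => [|h'] /=; ring.
congr (_ + _); last first.
  rewrite -/(W k); have [le_ik|lt_ki] := leqP i k.
    rewrite [in RHS]U_bound // mul0r big1 // => h _.
    by rewrite ltn_eqF ?mul0r // (leq_trans (ltn_ord h)).
  rewrite (bigD1 (Ordinal (lt_ki : (k.+1 < i.+1)%N))) //= eqxx mul1r.
  rewrite big1 ?addr0 // => h.
  by rewrite -val_eqE /= => /negPf ->; rewrite mul0r.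
rewrite /pairing [RHS]big_split /=; congr (_ + _).
  rewrite [RHS]big_ord_recl U_ground mul0r add0r.
  by apply: eq_bigr => h _; rewrite /= U_up.
(* The right side has two extra terms, at heights [i] and [i.+1]; by [U_down] they involve heights
   above [i] after [i] steps, so they vanish. *)
rewrite big_ord_recl !mul0r add0r [RHS]big_ord_recr big_ord_recr /= !U_down.
rewrite !U_bound // !mulr0 !addr0 !mul0r !addr0.
by apply: eq_bigr => h _; rewrite mul1r U_down.
Qed.

(** Iterating [pairing_step] hands all steps to the prefix; the final pairing is zero, so only the
    extracted terms remain. *)
Lemma sum_peaks_convolution k N :
  (sum_peaks a b k.+1 N.+1 0 false)%:R
    = a%:R * \sum_(i < N.+1) U i k.+1 true * (nb_completions a b (N - i) k false)%:R.
Proof.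
have pairing0 m : pairing k.+1 m 0 = (sum_peaks a b k.+1 m 0 false)%:R.
  by rewrite /pairing big_ord1 U_ground mul0r add0r U_init mul1r.
suffices partial i : (i <= N.+1)%N -> pairing k.+1 N.+1 0 = pairing k.+1 (N.+1 - i) i
    + a%:R * \sum_(j < i) U j k.+1 true * (nb_completions a b (N - j) k false)%:R.
  rewrite -pairing0 (partial N.+1) // subnn [pairing _ _ _]big1 ?add0r // => h _.
  by rewrite !sum_peaks0 !mulr0 addr0.
elim: i => [|i IHi] lt_iN; first by rewrite subn0 big_ord0 mulr0 addr0.
by rewrite IHi ?(ltnW lt_iN) // subSn // subSS pairing_step big_ord_recr /=; ring.
Qed.

End PrefixSuffix.

(** * Generating functions of prefixes and suffixes *)

Section Counting.
Variables a b : nat.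
Hypothesis b_gt0 : (0 < b)%N.
Local Notation X := (fps_X rat).
Local Notation C := (C_series a b).
Local Notation D := (fps_squareX C).

Lemma C_sqE : D = 1 + (a%:R - b%:R) * X ^+ 2 * D + b%:R * X ^+ 2 * D ^+ 2.
Proof.
move: (C_series a b) (C_series_sol a b_gt0) => c cE; rewrite {1}cE.
rewrite !(rmorphD, rmorphN, rmorphM, rmorphXn, rmorph1, rmorph_nat) /=.
by rewrite fps_squareX_X.
Qed.

Lemma C_series0 : C 0%N = 1.
Proof.
rewrite (C_series_sol a b_gt0) !coef_fpsD coef_fps1 ![_ * X]mulrC -!mulrA.
by rewrite !coef_fpsXM !addr0.
Qed.

Lemma coef0_expC r : (C ^+ r) 0%N = 1.
Proof.
elim: r => [|r IHr]; first by rewrite coef_fps1.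
by rewrite exprS coef_fpsM big_ord1 C_series0 IHr mulr1.
Qed.

Lemma coef_expCS r m :
  (C ^+ r.+1) m.+1
    = (C ^+ r) m.+1 + (a%:R - b%:R) * (C ^+ r.+1) m + b%:R * (C ^+ r.+2) m.
Proof.
have {1}-> : C ^+ r.+1 = C ^+ r + X * ((a%:R - b%:R) * C ^+ r.+1 + b%:R * C ^+ r.+2).
  by rewrite exprS {1}(C_series_sol a b_gt0) !exprS; ring.
rewrite coef_fpsD coef_fpsXM coef_fpsD mulrBl coef_fpsB !coef_fps_natM.
by rewrite mulrBl addrA.
Qed.

(** The second summand corrects the case where the first step is a d-step right after a u-step: it
    has [a] colors instead of [b]. *)
Definition suffix_series h (f : bool) : fps rat :=
  (b%:R * X) ^+ h * D ^+ h.+1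
  + (f && (0 < h)%N)%:R * (a%:R - b%:R) * X * (b%:R * X) ^+ h.-1 * D ^+ h.

(** All prefixes to height [h] give [X ^+ h * D ^+ h.+1]; those ending with a u-step give
    [X ^+ h * D ^+ h], and exist only for positive [h]. *)
Definition prefix_series h (f : bool) : fps rat :=
  X ^+ h * (D ^+ h * (if f then (0 < h)%:R else D - (0 < h)%:R)).

Lemma suffix_seriesE h f :
  suffix_series h f
    = (h == 0%N)%:R
      + X * (suffix_series h.+1 true
             + ((0 < h) * down_weight a b f)%:R * suffix_series h.-1 false).
Proof.
rewrite /suffix_series; case: h => [|h].
  by rewrite ltnn !andbF {1}C_sqE mul0n /=; ring.
have -> : (((0 < h.+1) * down_weight a b f)%N%:R : fps rat)
    = b%:R + f%:R * (a%:R - b%:R) by rewrite mul1n; case: f => /=; ring.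
(* Once this factor is isolated, expanding the single [D] of [b%:R * D] by [C_sqE] gives the right
   side. *)
transitivity (X * (b%:R * X) ^+ h * D ^+ h.+1 * (b%:R * D + f%:R * (a%:R - b%:R))).
  by rewrite ltn0Sn andbT /= !exprS; ring.
by rewrite {2}C_sqE !ltn0Sn /= !exprS; ring.
Qed.

Lemma prefix_seriesS h : 
  prefix_series h.+1 true = X * (prefix_series h true + prefix_series h false).
Proof. by rewrite /prefix_series /= !exprS; ring. Qed.

Lemma prefix_series0 : prefix_series 0 true = 0.
Proof. by rewrite /prefix_series /= !mulr0. Qed.

Lemma prefix_series_false h :
  prefix_series h false
    = (h == 0%N)%:R
      + X * (a%:R * prefix_series h.+1 true + b%:R * prefix_series h.+1 false).
Proof.
rewrite /prefix_series /=.
transitivity (X ^+ h * (D ^+ h * (1 - (0 < h)%:R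
    + (a%:R - b%:R) * X ^+ 2 * D + b%:R * X ^+ 2 * D ^+ 2))).
  by rewrite {2}C_sqE; congr (_ * (_ * _)); ring.
by case: h => [|h] /=; rewrite !exprS; ring.
Qed.

Lemma coef_prefix_series_small h f i : (i < h)%N -> prefix_series h f i = 0.
Proof. by move=> lt_ih; rewrite coef_fpsXnM leqNgt lt_ih. Qed.

Lemma coef_prefix_series0 : prefix_series 0 false 0%N = 1.
Proof.
rewrite /prefix_series !expr0 !mul1r subr0 -[0%N]/(0.*2).
by rewrite coef_squareX_double C_series0.
Qed.

Lemma coef_suffix_series m h f :
  (nb_completions a b m h f)%:R = suffix_series h f m.
Proof.
elim: m h f => [|m IHm] h f; rewrite suffix_seriesE coef_fpsD coef_fpsXM fps_natr.
  by rewrite addr0 nb_completions0.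
by rewrite add0r coef_fpsD coef_fps_natM -!IHm -natrM -natrD nb_completionsS.
Qed.

Lemma total_peaks_coef n l :
  (total_peaks a b n l)%:R = a%:R * (b%:R ^+ l * (X ^+ l * C ^+ (2 * l + 2)) n).
Proof.
rewrite total_peaksE addn2 mul2n.
rewrite (@sum_peaks_convolution _ a b (fun i h f => prefix_series h f i)).
- congr (_ * _); under eq_bigr do rewrite coef_suffix_series.
  rewrite -coef_fpsM.
  (* The total power of [X] is [2 * l + 1]: one [X] comes out and the rest is a series in [X ^+ 2],
     so index [2n+1] becomes index [n]. *)
  have -> : prefix_series l.+1 true * suffix_series l false
      = X * fps_squareX (b%:R ^+ l * (X ^+ l * C ^+ (2 * l + 2))).
    rewrite /prefix_series /suffix_series; move: (C_series a b) => c.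
    rewrite !(rmorphM, rmorphXn, rmorph_nat) /= fps_squareX_X.
    rewrite -!exprM addn2 !mul2n -!addnn.
    by rewrite !exprS !exprD !exprMn !mul0r; ring.
  by rewrite coef_fpsXM coef_squareX_double coef_fps_natXM.
- exact: coef_prefix_series0.
- by move=> i h f; exact: coef_prefix_series_small.
- by move=> i; rewrite prefix_series0 coef_fps0.
- by move=> i h; rewrite prefix_seriesS coef_fpsXM.
move=> i h; rewrite prefix_series_false coef_fpsD fps_natr [X in X + _]/= add0r.
by rewrite coef_fpsXM coef_fpsD !coef_fps_natM.
Qed.

(** * Closed form of the coefficients of powers of [C] *)

Definition catalan_term r m j : rat :=
  r%:R / (2 * m + r - j)%:R * 'C(2 * m + r - j, m)%:R * 'C(m, j)%:R.

(* [u] stands for 'C(m, j - 1), read as 0 when j = 0. *)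
Lemma catalan_term_rec r m j u (v := 'C(m, j)%:R : rat) :
    (j <= m.+1)%N -> (m.+1%:R * u = j%:R * (u + v)) -> 'C(m.+1, j)%:R = u + v ->
  catalan_term r.+1 m.+1 j
    = catalan_term r m.+1 j
      + r.+1%:R / (2 * m + r + 2 - j)%:R * 'C(2 * m + r + 2 - j, m)%:R * u
      + catalan_term r.+2 m j.
Proof.
move=> le_jm uE sE; rewrite /catalan_term sE -/v; clearbody v.
have [N [NE N_gt0]] : exists N, (N + j = 2 * m + r + 2)%N /\ (0 < N)%N.
  by exists (2 * m + r + 2 - j)%N; lia.
have -> : (2 * m.+1 + r.+1 - j = N.+1)%N by lia.
have -> : (2 * m.+1 + r - j = N)%N by lia.
have -> : (2 * m + r.+2 - j = N)%N by lia.
have -> : (2 * m + r + 2 - j = N)%N by lia.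
have PE : N.+1%:R * 'C(N, m)%:R = m.+1%:R * ('C(N, m.+1)%:R + 'C(N, m)%:R) :> rat.
  by rewrite -natrD -binS -!natrM mul_bin_diag.
rewrite binS natrD.
have jE : j%:R = 2 * m%:R + r%:R + 2 - N%:R :> rat.
  by rewrite -[2]/(2%:R) -natrM -!natrD -NE natrD; ring.
rewrite jE in uE.
move: PE uE; move: ('C(N, m)%:R) ('C(N, m.+1)%:R) => p q PE uE.
have N0 : N%:R != 0 :> rat by rewrite pnatr_eq0 -lt0n.
have NS0 : N%:R + 1 != 0 :> rat by rewrite natr1 pnatr_eq0.
have m0 : m%:R + 1 != 0 :> rat by rewrite natr1 pnatr_eq0.
(* Ratios of neighbouring binomials express [q] through [p], and [u] through [w = u + v]; a rational
   identity with [p] and [w] free remains. *)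
have qE : q = (N%:R - m%:R) * p / (m%:R + 1).
  by apply: (mulfI m0); rewrite mulrCA divff // mulr1; move: PE; rewrite -!natr1; lra.
have [w vE] : exists w, v = w - u by exists (u + v); rewrite addrC addKr.
rewrite vE [u + _]addrC subrK in uE *.
have {}uE : u = (2 * m%:R + r%:R + 2 - N%:R) * w / (m%:R + 1).
  by apply: (mulfI m0); rewrite mulrCA divff // mulr1; move: uE; rewrite -!natr1; lra.
rewrite qE uE -!natr1; field.
by rewrite m0 NS0 N0.
Qed.

(** Induction on [m], then on [r], along [coef_expCS]. At [r = m = 0] the coefficient is 1, but
    [catalan_term] is 0 since division by zero gives 0. *)
Lemma coef_expC r m : (0 < r + m)%N ->
  (C ^+ r) m
    = \sum_(j < m.+1) catalan_term r m j * (a%:R - b%:R) ^+ j * b%:R ^+ (m - j).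
Proof.
elim: m r => [|m IHm] r.
  rewrite addn0 => r_gt0; rewrite coef0_expC big_ord1 /catalan_term.
  by rewrite muln0 add0n subn0 !bin0 !mulr1 divff // pnatr_eq0 -lt0n.
elim: r => [|r IHr] _.
  rewrite coef_fps1 big1 // => j _.
  by rewrite /catalan_term !mul0r.
rewrite coef_expCS IHr ?addnS // !IHm ?addSn //.
move: (a%:R - b%:R) => d.
pose F k n j := catalan_term k n j * d ^+ j * b%:R ^+ (n - j).
(* The sums are aligned on [j <= m.+1]: the factor [d] shifts [j] by one here, and the next sum
   gains a term that is zero because ['C(m, m.+1)] is. *)
have -> : d * \sum_(j < m.+1) F r.+1 m j
    = \sum_(j < m.+2) (if (j : nat) is i.+1 then d * F r.+1 m i else 0).
  by rewrite mulr_sumr [RHS]big_ord_recl add0r.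
have -> : b%:R * \sum_(j < m.+1) F r.+2 m j
    = \sum_(j < m.+2) catalan_term r.+2 m j * d ^+ j * b%:R ^+ (m.+1 - j).
  rewrite mulr_sumr [RHS]big_ord_recr /= [in X in _ + X]/catalan_term.
  rewrite (@bin_small m) // mulr0 !mul0r addr0; apply: eq_bigr => j _.
  have le_jm : (j <= m)%N by rewrite -ltnS.
  by rewrite (subSn le_jm) /F exprS; ring.
rewrite -!big_split; apply: eq_bigr => -[[|j] lt_j] _ /=.
  rewrite (@catalan_term_rec r m 0 0) ?bin0 ?mul0r ?mulr0 ?add0r //.
  by ring.
rewrite (@catalan_term_rec r m j.+1 'C(m, j)%:R) //.
- rewrite /F /catalan_term !exprS subSS.
  have -> : (2 * m + r + 2 - j.+1 = 2 * m + r.+1 - j)%N by lia.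
  by ring.
- by rewrite -natrD -!natrM addnC -binS mul_bin_diag.
- by rewrite -natrD addnC -binS.
Qed.

Lemma total_peaks_sum n l : (l <= n)%N ->
  (total_peaks a b n l)%:R
    = a%:R * \sum_(j < (n - l).+1)
        catalan_term (2 * l + 2) (n - l) j * (a%:R - b%:R) ^+ j * b%:R ^+ (n - j).
Proof.
move=> le_ln; rewrite total_peaks_coef coef_fpsXnM le_ln coef_expC; last by lia.
rewrite mulr_sumr; congr (_ * _); apply: eq_bigr => j _.
have -> : (n - j = l + (n - l - j))%N by have := ltn_ord j; lia.
by rewrite exprD; ring.
Qed.

End Counting.

Theorem theorem7p3 (a b : nat) (ha : (0 < a)%N) (hb : (0 < b)%N) :
  (forall n l : nat, (l <= n)%N ->
     (total_peaks a b n l)%:R =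
       \sum_(0 <= j < (n - l).+1)
         (2 * a * (l + 1))%:R / (2 * n - j + 2)%:R
         * 'C(2 * n - j + 2, n - l)%:R * 'C(n - l, j)%:R
         * (a%:R - b%:R) ^+ j * b%:R ^+ (n - j) :> rat)
  /\ total_peaks a b 0 0 = a
  /\ (forall n l : nat, (l <= n)%N ->
     (total_peaks a b n l)%:R =
       riordan (a%:R * C_series a b ^+ 2)
               (b%:R * fps_X rat * C_series a b ^+ 2) n l).
Proof.
split; [|split] => [n l le_ln||n l _].
- rewrite total_peaks_sum // mulr_sumr big_mkord; apply: eq_bigr => j _.
  rewrite /catalan_term.
  have -> : (2 * (n - l) + (2 * l + 2) - j = 2 * n - j + 2)%N.
    by have := ltn_ord j; lia.
  by rewrite !(natrM, natrD); ring.
- apply/eqP; rewrite -(eqr_nat rat) total_peaks_sum // big_ord1 /catalan_term.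
  by rewrite !bin0 divff // !mulr1.
rewrite total_peaks_coef // /riordan.
have -> : a%:R * C_series a b ^+ 2 * (b%:R * fps_X rat * C_series a b ^+ 2) ^+ l
    = a%:R * (b%:R ^+ l * (fps_X rat ^+ l * C_series a b ^+ (2 * l + 2))).
  by move: (C_series a b) => c; rewrite !exprMn mul2n -addnn !exprD; ring.
by rewrite coef_fps_natM coef_fps_natXM.
Qed.
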